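(* Let $G:\mathbb{R}^p\to\mathbb{R}^p$ be single-valued and $\frac1L$-co-coercive with $L>0$ and $G^{-1}(0)\neq\emptyset$. Let $y_0\in\mathbb{R}^p$, and let $\beta_k\in(0,1)$, $\eta_k>0$, $\gamma_k>0$ ($k\ge 0$) be given parameters. Put $x_0=x_{-1}=y_{-1}:=y_0$, $\beta_{-1}:=1$, $\eta_{-1}:=0$, and let $\gamma_{-1}>0$ be arbitrary. Let $\{x_k\}$ and $\{y_k\}$ be generated, for $k\ge 0$, by $$\begin{cases} x_{k+1} := y_k-\gamma_k Gy_k,\\ y_{k+1} := x_{k+1}+\theta_k(x_{k+1}-x_k)+\nu_k(y_k-x_{k+1})+\kappa_k(y_{k-1}-x_k),\end{cases}\qquad (\ast)$$ where $$\theta_k:=\frac{\beta_k(1-\beta_{k-1})}{\beta_{k-1}},\qquad \nu_k:=\frac{\beta_k}{\beta_{k-1}}+1-\beta_k-\frac{\eta_k}{\gamma_k},\qquad \kappa_k:=\frac{\beta_k}{\beta_{k-1}}\left(\frac{\eta_{k-1}}{\gamma_{k-1}}-1+\beta_{k-1}\right).$$ Then the sequence $\{y_k\}$ is identical to the sequence generated from the same $y_0$ by the Halpern fixed-point scheme $$y_{k+1}:=\beta_k y_0+(1-\beta_k)y_k-\eta_k Gy_k,\qquad k\ge 0.$$ In particular, if $\gamma_k:=\frac{\eta_k}{1-\beta_k}$ for all $k\ge 0$, then $\nu_k=\frac{\beta_k}{\beta_{k-1}}$, $\kappa_k=0$, and $(\ast)$ reduces to $$\begin{cases} x_{k+1}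 := y_k-\gamma_k Gy_k,\\ y_{k+1} := x_{k+1}+\theta_k(x_{k+1}-x_k)+\nu_k(y_k-x_{k+1}).\end{cases}$$
   Context: $G$ is $\frac1L$-co-coercive if $\langle Gx-Gy,x-y\rangle\ge \frac1L\|Gx-Gy\|^2$ for all $x,y\in\mathbb{R}^p$. The problem under consideration is to find $y^\star$ with $Gy^\star=0$. *)

(* Defs.v *)
From mathcomp Require Export all_boot all_order all_algebra.
From mathcomp Require Export reals.
Export GRing.Theory Num.Theory.

Set Implicit Arguments.
Unset Strict Implicit.
Unset Printing Implicit Defensive.

Local Open Scope ring_scope.

Definition dotp (R : realType) (p : nat) (u v : 'cV[R]_p) : R :=
  \sum_(i < p) u i 0 * v i 0.

(* The norm MathComp-Analysis puts on matrices is the sup norm, hence this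
   separate definition. *)
Definition enorm (R : realType) (p : nat) (u : 'cV[R]_p) : R :=
  Num.sqrt (dotp u u).

Definition cocoercive (R : realType) (p : nat) (c : R)
    (G : 'cV[R]_p -> 'cV[R]_p) : Prop :=
  forall x y : 'cV[R]_p, c * enorm (G x - G y) ^+ 2 <= dotp (G x - G y) (x - y).

(* Sequences indexed by k >= -1 are functions on int; their values below -1
   are never used.  A natural number k is silently read as an int. *)

Definition theta (R : realType) (beta : int -> R) (k : int) : R :=
  beta k * (1 - beta (k - 1)) / beta (k - 1).

Definition nu (R : realType) (beta eta gamma : int -> R) (k : int) : R :=
  beta k / beta (k - 1) + 1 - beta k - eta k / gamma k.

Definition kappa (R : realType) (beta eta gamma : int -> R) (k : int) : R :=
  beta k / beta (k - 1) * (eta (k - 1) / gamma (k - 1) - 1 + beta (k - 1)).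

Definition nesterov_init (R : realType) (p : nat) (y0 : 'cV[R]_p)
    (x y : int -> 'cV[R]_p) : Prop :=
  [/\ y 0 = y0, x 0 = y0, x (-1) = y0 & y (-1) = y0].

Definition nesterov_scheme (R : realType) (p : nat) (G : 'cV[R]_p -> 'cV[R]_p)
    (beta eta gamma : int -> R) (x y : int -> 'cV[R]_p) : Prop :=
  forall k : nat,
    x k.+1 = y k - gamma k *: G (y k) /\
    y k.+1 = x k.+1 + theta beta k *: (x k.+1 - x k)
                    + nu beta eta gamma k *: (y k - x k.+1)
                    + kappa beta eta gamma k *: (y (k%:Z - 1) - x k).

Definition nesterov_scheme_no_kappa (R : realType) (p : nat)
    (G : 'cV[R]_p -> 'cV[R]_p)
    (beta eta gamma : int -> R) (x y : int -> 'cV[R]_p) : Prop :=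
  forall k : nat,
    x k.+1 = y k - gamma k *: G (y k) /\
    y k.+1 = x k.+1 + theta beta k *: (x k.+1 - x k)
                    + nu beta eta gamma k *: (y k - x k.+1).

Fixpoint halpern (R : realType) (p : nat) (G : 'cV[R]_p -> 'cV[R]_p)
    (beta eta : int -> R) (y0 : 'cV[R]_p) (n : nat) : 'cV[R]_p :=
  if n is k.+1 then
    let yk := halpern G beta eta y0 k in
    beta k *: y0 + (1 - beta k) *: yk - eta k *: G yk
  else y0.

(* Main.v *)
(* Write [r_k = eta_k / gamma_k] and consider the vector
     [a_k = y_k - r_(k-1) x_k - (1 - beta_(k-1) - r_(k-1)) y_(k-1)].
   The second line of the scheme says exactly that
   [a_(k+1) = beta_k / beta_(k-1) a_k], and [a_0 = y_0] by the conventions at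
   index [-1]; telescoping gives [a_(k+1) = beta_k y_0], which is the Halpern
   step once [x_(k+1)] is replaced by [y_k - gamma_k G y_k]. *)

Require Import Defs.
From mathcomp Require Import ring.

Local Open Scope ring_scope.

Lemma intS_sub1 (k : nat) : k.+1%:Z - 1 = k.
Proof. by rewrite intS addrC addKr. Qed.

Section Anchor.

Set Implicit Arguments.
Unset Strict Implicit.

Variables (R : realType) (p : nat) (G : 'cV[R]_p -> 'cV[R]_p).
Variables (beta eta gamma : int -> R).

Definition anchor (x y : int -> 'cV[R]_p) (k : int) : 'cV[R]_p :=
  let r := eta (k - 1) / gamma (k - 1) in
  y k - r *: x k - (1 - beta (k - 1) - r) *: y (k - 1).

Lemma anchor_recurrence (x y : int -> 'cV[R]_p) (k : nat) :
  beta (k%:Z - 1) != 0 ->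
  nesterov_scheme G beta eta gamma x y ->
  anchor x y k.+1 = (beta k / beta (k%:Z - 1)) *: anchor x y k.
Proof.
move=> hb /(_ k)[_ hy]; rewrite /anchor intS_sub1 hy /theta /nu /kappa.
(* With both ratios opaque, [beta (k - 1)] is the only denominator left for [field]. *)
move: (eta k / gamma k) (eta (k%:Z - 1) / gamma (k%:Z - 1)) => r r'.
by apply/matrixP=> i j; rewrite !mxE; field.
Qed.

Lemma anchorE (y0 : 'cV[R]_p) (x y : int -> 'cV[R]_p) (k : nat) :
  (forall j : nat, beta j != 0) -> beta (-1) = 1 -> eta (-1) = 0 ->
  nesterov_init y0 x y -> nesterov_scheme G beta eta gamma x y ->
  anchor x y k = beta (k%:Z - 1) *: y0.
Proof.
move=> hb hb1 he1 [hy0 _ _ _] hs; elim: k => [|k IHk].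
  (* Both subtracted terms have coefficient zero: [eta (-1) = 0] kills the ratio, then
     [beta (-1) = 1] kills the other coefficient. *)
  by rewrite /anchor !sub0r hb1 he1 hy0 mul0r subrr !subr0 !scale0r !subr0 scale1r.
have hbk : beta (k%:Z - 1) != 0.
  by case: (k) => [|j]; rewrite ?intS_sub1 // sub0r hb1 oner_neq0.
by rewrite (anchor_recurrence hbk hs) IHk scalerA divfK // intS_sub1.
Qed.

(** Since [r_k * gamma_k = eta_k], the term [r_k x_(k+1)] equals [r_k y_k - eta_k G y_k], and its
    [r_k y_k] cancels the one in the coefficient of [y_k]. *)
Lemma anchor_halpern_step (y0 : 'cV[R]_p) (x y : int -> 'cV[R]_p) (k : nat) :
  gamma k != 0 -> nesterov_scheme G beta eta gamma x y ->
  anchor x y k.+1 = beta k *: y0 ->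
  y k.+1 = beta k *: y0 + (1 - beta k) *: y k - eta k *: G (y k).
Proof.
move=> hg /(_ k)[hx _]; rewrite /anchor intS_sub1 hx => <-.
by apply/matrixP=> i j; rewrite !mxE; field.
Qed.

(** This choice of [gamma] amounts to [eta_j / gamma_j = 1 - beta_j], which cancels the bracket in
    [kappa]. *)
Lemma nu_kappaE (k : nat) :
  (forall j : nat, 1 - beta j != 0) -> (forall j : nat, eta j != 0) ->
  beta (-1) = 1 -> eta (-1) = 0 ->
  (forall j : nat, gamma j = eta j / (1 - beta j)) ->
  nu beta eta gamma k = beta k / beta (k%:Z - 1) /\ kappa beta eta gamma k = 0.
Proof.
move=> hb he hb1 he1 hg.
have ratioE (j : nat) : eta j / gamma j = 1 - beta j.
  by rewrite hg invf_div mulrC divfK.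
split; first by rewrite /nu ratioE; ring.
(* The formula for [gamma] does not reach index -1; there the conventions make both the ratio and
   [1 - beta (-1)] zero. *)
rewrite /kappa; case: k => [|k]; first by rewrite sub0r hb1 he1; ring.
by rewrite intS_sub1 ratioE; ring.
Qed.

End Anchor.

Theorem theorem2 (R : realType) (p : nat) (G : 'cV[R]_p -> 'cV[R]_p) (L : R)
  (hL : 0 < L) (hG : cocoercive L^-1 G)
  (hzero : exists ystar : 'cV[R]_p, G ystar = 0)
  (y0 : 'cV[R]_p) (beta eta gamma : int -> R)
  (hbeta : forall k : nat, 0 < beta k < 1)
  (heta : forall k : nat, 0 < eta k)
  (hgamma : forall k : nat, 0 < gamma k)
  (hbeta_m1 : beta (-1) = 1) (heta_m1 : eta (-1) = 0)
  (hgamma_m1 : 0 < gamma (-1)) :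
  (forall x y : int -> 'cV[R]_p,
     nesterov_init y0 x y -> nesterov_scheme G beta eta gamma x y ->
     forall k : nat, y k = halpern G beta eta y0 k) /\
  ((forall k : nat, gamma k = eta k / (1 - beta k)) ->
   (forall k : nat,
      nu beta eta gamma k = beta k / beta (k%:Z - 1) /\
      kappa beta eta gamma k = 0) /\
   (forall x y : int -> 'cV[R]_p,
      nesterov_scheme G beta eta gamma x y <->
      nesterov_scheme_no_kappa G beta eta gamma x y)).
Proof.
have hb (k : nat) : beta k != 0 by case/andP: (hbeta k) => /lt0r_neq0.
have hb' (k : nat) : 1 - beta k != 0.
  by apply: lt0r_neq0; rewrite subr_gt0; case/andP: (hbeta k).
split=> [x y hinit hs|hgammaE].
  elim=> [|k IHk] /=; first by case: hinit.
  rewrite -IHk; apply: (anchor_halpern_step (lt0r_neq0 (hgamma k)) hs).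
  by rewrite (anchorE _ hb hbeta_m1 heta_m1 hinit hs) intS_sub1.
have nukappa (k : nat) :=
  nu_kappaE k hb' (fun j => lt0r_neq0 (heta j)) hbeta_m1 heta_m1 hgammaE.
split=> // x y.
(* The schemes differ by one summand, which vanishes with [kappa], so the same rewriting serves both
   directions. *)
by split=> hs k; have [hx hy] := hs k; have [_ hk] := nukappa k; split;
  rewrite // hy hk scale0r addr0.
Qed.
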